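(* Let $M$ be a simplicial complex which is not a simplex and let $K \supsetneq L$ be a pair of simplicial complexes such that $\mathbf{F}_L \subset \mathbf{F}_K$. If $\mathcal{Z}^*_M(K,L)$ is shellable, then both $K$ and $L$ are shellable.
   Context: A simplicial complex $K$ is a collection of finite subsets (simplices) of a set $V(K)$ closed under taking subsets, with $\{v\}\in K$ for all $v\in V(K)$. The dimension is $\dim K=\max_{\sigma\in K}|\sigma|-1$; all simplicial complexes are nonempty (they contain $\emptyset$) and finite-dimensional. A facet is an inclusion-maximal simplex; $\mathbf{F}_X$ denotes the set of all facets of $X$. A complex is pure if all its facets have the same cardinality. A pair of simplicial complexes $K\supset L$ consists of a simplicial complex $K$ and a subcomplex $L$ of $K$ (so $V(L)\subset V(K)$); $K\supsetneq L$ means moreover $K\neq L$. A complex $M$ is a simplex if $V(M)\in M$. $K$ is shellable (in the non-pure sense) if its facets can be arranged in a linear order $F_1,\dots,F_t$ (a shelling) such that for all $k=2,\dots,t$ the subcomplex $\left(\bigcup_{i=1}^{k-1}\langle F_i\rangle\right)\cap\langle F_k\rangle$ is pure and $(|F_k|-2)$-dimensional, where $\langle F\rangle$ is the complex of all subsets of $F$. The join of $K_1,\dots,K_m$ is $K_1*\cdots*K_m=\{\sigma\subset\bigsqcup_{i}V(K_i) : \sigma\cap V(K_i)\in K_i \text{ for all } i\}$. Let $M$ be a simplicial complex with vertex set $V(M)=[m]=\{1,\dots,m\}$, $m\ge1$. The polyhedral join is the subcomplex $\mathcal{Z}^*_M(K,L)=\bigcup_{S\in M}X^S_1*\cdots*X^S_m$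 of the join of $m$ disjoint copies of $K$, where $X^S_i$ is the $i$-th copy of $K$ if $i\in S$ and the $i$-th copy of $L$ if $i\notin S$. *)

(* Defs.v *)
From mathcomp Require Import all_boot all_order all_algebra.
From mathcomp Require Import finmap boolp classical_sets.

Set Implicit Arguments.
Unset Strict Implicit.
Unset Printing Implicit Defensive.

Local Open Scope classical_set_scope.

Section SimplicialComplex.
Variable V : choiceType.
Implicit Types (K : set {fset V}) (F G : {fset V}).

(* The ambient type V may be larger than V(K) and may be infinite, and K may
   have infinitely many simplices. *)
Definition vertices K : set V := [set v | K [fset v]%fset].

Definition simplicial_complex K : Prop :=
  [/\ K fset0,
      forall F G, K F -> (G `<=` F)%fset -> K G
    & exists n : nat, forall F, K F -> #|` F| <= n].

Definition is_simplex K : Prop :=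
  exists2 F : {fset V}, K F & [set` F] = vertices K.

(* The value is an integer: the complex {fset0} has dimension -1. *)
Definition has_dim K (d : int) : Prop :=
  (exists2 F, K F & (#|` F|%:Z - 1)%R = d) /\
  (forall F, K F -> (#|` F|%:Z - 1 <= d)%R).

Definition facets K : set {fset V} :=
  [set F | K F /\ forall G, K G -> (F `<=` G)%fset -> G = F].

Definition pure K : Prop :=
  forall F G, facets K F -> facets K G -> #|` F| = #|` G|.

Definition full_simplex F : set {fset V} := [set G | (G `<=` F)%fset].

(* Facets are indexed from 0, so the condition bears on 1 <= k < size s. *)
Definition shelling K (s : seq {fset V}) : Prop :=
  [/\ uniq s,
      [set` s] = facets K
    & forall k, 0 < k < size s ->
        let Fk := nth fset0 s k in
        let X := (\bigcup_(i in [set i : nat | i < k])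
                    full_simplex (nth fset0 s i)) `&` full_simplex Fk in
        pure X /\ has_dim X (#|` Fk|%:Z - 2)%R].

Definition shellable K : Prop := exists s : seq {fset V}, shelling K s.

End SimplicialComplex.

Section PolyhedralJoin.
Variables (V : choiceType) (m : nat).

(* The i-th of the m disjoint copies of V is the set of pairs (i, v). *)
Definition slice (i : 'I_m) (F : {fset 'I_m * V}) : {fset V} :=
  [fset p.2 | p in F & p.1 == i]%fset.

Definition join (X : 'I_m -> set {fset V}) : set {fset 'I_m * V} :=
  [set F | forall i, X i (slice i F)].

Definition polyhedral_join (M : set {fset 'I_m}) (K L : set {fset V}) :
    set {fset 'I_m * V} :=
  \bigcup_(S in M) join (fun i => if i \in S then K else L).

End PolyhedralJoin.

(* Main.v *)
Require Import Defs.
From mathcomp Require Import all_boot all_order all_algebra.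
From mathcomp Require Import finmap boolp classical_sets.
From mathcomp Require Import zify.

Local Open Scope classical_set_scope.

(** Links of shellable complexes are shellable, and both [K] and [L] are links
    in the polyhedral join.  Let [G0] be a facet of [L], hence of [K].  Putting
    [G0] in every copy but one gives a simplex whose link is [K].  Let [F0] be
    a facet of [K] outside [L], [S] a facet of [M] and [i \notin S], which
    exists because [M] is not a simplex.  Putting [F0] in the copies indexed by
    [S] and [G0] in the others except the [i]-th gives a simplex whose link is
    [L]: a non-face of [L] in the [i]-th copy would require
    [i |` S] to be a simplex of [M]. *)

Section Shellings.
Variable V : choiceType.
Implicit Types (K : set {fset V}) (F G H : {fset V}) (s : seq {fset V}).

(** Induction on the gap between [n] and the cardinality of [F]: the bound stops every chain of
    proper enlargements, even when [K] is infinite. *)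
Lemma exists_facet K (n : nat) F :
  (forall G, K G -> #|` G| <= n) -> K F ->
  exists2 G, facets K G & (F `<=` G)%fset.
Proof.
move=> Kn; have [k] := ubnP (n - #|` F|); elim: k F => // k IHk F lek KF.
have [maxF|] := pselect (forall G, K G -> (F `<=` G)%fset -> G = F).
  by exists F.
move=> /existsNP[G /not_implyP[KG /not_implyP[FG /eqP GF]]].
have ltFG : #|` F| < #|` G| by rewrite fproper_ltn_card // fproperEneq eq_sym GF.
have [|H KH GH] := IHk G _ KG; first by have := Kn _ KG; lia.
by exists H => //; apply: fsubset_trans GH.
Qed.

Lemma subseq_pair_nth s i k : i < k < size s ->
  subseq [:: nth fset0 s i; nth fset0 s k] s.
Proof.
elim: s i k => [|F s IHs] [|i] [|k] // ltik; rewrite ?andbF // in ltik.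
  by rewrite /= eqxx sub1seq mem_nth.
exact: subseq_trans (IHs i k ltik) (subseq_cons _ _).
Qed.

Lemma nth_subseq_pair s G F : subseq [:: G; F] s ->
  exists i k, [/\ i < k < size s, nth fset0 s i = G & nth fset0 s k = F].
Proof.
elim: s => //= E s IHs; have [<-|_] := eqVneq G E.
  rewrite sub1seq => Fs; exists 0, (index F s).+1.
  by split=> //=; rewrite ?ltnS ?index_mem ?nth_index.
by move=> /IHs[i [k [ik <- <-]]]; exists i.+1, k.+1.
Qed.

(* As facets are pairwise distinct, [subseq [:: G; F] s] says that [G] comes
   before [F] in [s]. *)
Definition shelling_order s : Prop :=
  forall G F, subseq [:: G; F] s ->
  exists H, [/\ subseq [:: H; F] s, (G `&` F `<=` H)%fset & #|` F `\` H|%fset = 1].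

(** Purity in codimension one means that each intersection of a facet with an earlier one extends to
    such an intersection missing a single vertex. This pairwise form is the one that passes to the
    facets containing a fixed simplex. *)
Lemma shellingP K s :
  shelling K s <-> [/\ uniq s, [set` s] = facets K & shelling_order s].
Proof.
split=> -[us sK sh]; split=> //.
- move=> G F /nth_subseq_pair[i [k [/andP[ik ks] <- <-]]].
  have [|pureX [[E XE cardE] dimX]] := sh k; first by rewrite ks; lia.
  set X := (X in pure X) in pureX XE dimX.
  set Fk := nth fset0 s k in pureX XE cardE dimX *.
  (* [E] attains the dimension of [X], so purity gives every facet of [X] one vertex less than
     [Fk]. *)
  have facetE : facets X E.
    split=> // E' XE' EE'; apply/esym/eqP; rewrite eqEfcard EE' /=.
    by have := dimX _ XE'; lia.
  have XI j : j < k -> X (nth fset0 s j `&` Fk)%fset.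
    by move=> jk; split; [exists j => //; exact: fsubsetIl|exact: fsubsetIr].
  have [|H XH iH] := @exists_facet X #|` Fk| _ _ (XI i ik).
    by move=> H [_ /fsubset_leq_card].
  have cardH := pureX _ _ XH facetE.
  have [[[j /= jk Hj] Hk] _] := XH.
  exists (nth fset0 s j); split.
  + by apply: subseq_pair_nth; rewrite jk.
  + exact: fsubset_trans iH Hj.
  + have := dimX _ (XI j jk).
    have : #|` H| <= #|` nth fset0 s j `&` Fk|%fset.
      by apply: fsubset_leq_card; rewrite fsubsetI Hj.
    have := cardfsID (nth fset0 s j) Fk; rewrite fsetIC.
    lia.
- move=> k /andP[k0 ks] /=.
  set Fk := nth fset0 s k.
  set X := (X in pure X).
  have step i : i < k -> exists j, [/\ j < k,
      (nth fset0 s i `&` Fk `<=` nth fset0 s j `&` Fk)%fset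
      & #|` nth fset0 s j `&` Fk|%fset.+1 = #|` Fk|].
    move=> ik; have [|H [/nth_subseq_pair[j [k' [/andP[jk' k's] <- Ek']]] sub card1]] :=
      sh (nth fset0 s i) Fk; first by apply: subseq_pair_nth; rewrite ik.
    (* As [s] has no repetitions, [Fk] occurs only at position [k]. *)
    have k'E : k' = k by apply/eqP; rewrite -(nth_uniq fset0 k's ks us) Ek'.
    exists j; split; first by rewrite -k'E.
      by rewrite fsubsetI sub fsubsetIr.
    by have := cardfsID (nth fset0 s j) Fk; rewrite fsetIC; lia.
  have XI j : j < k -> X (nth fset0 s j `&` Fk)%fset.
    by move=> jk; split; [exists j => //; exact: fsubsetIl|exact: fsubsetIr].
  have sub_ridge G : X G -> exists H, [/\ X H, (G `<=` H)%fset & #|` H|.+1 = #|` Fk|].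
    move=> [[i /= ik Gi] Gk]; have [j [jk sub cardj]] := step i ik.
    exists (nth fset0 s j `&` Fk)%fset; split=> //; first exact: XI.
    by apply: fsubset_trans sub; rewrite fsubsetI Gi.
  have card_facet G : facets X G -> #|` G|.+1 = #|` Fk|.
    by move=> [XG maxG]; have [H [XH GH <-]] := sub_ridge G XG; rewrite (maxG H).
  split; first by move=> F G /card_facet FE /card_facet GE; lia.
  (* As [0 < k], the facet at index 0 provides a simplex of [X] to enlarge. *)
  split; first by have [H [XH _ cardH]] := sub_ridge _ (XI 0 k0); exists H => //; lia.
  by move=> G /sub_ridge[H [_ /fsubset_leq_card leGH cardH]]; lia.
Qed.

End Shellings.

(* The hypotheses say that [C] is isomorphic, via the vertex map [g], to the
   link of [tau] in [Z].  Facets containing [tau] keep their order: if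
   [G `&` F `<=` H] and [tau] lies in [G] and [F], then it lies in [H]. *)
Lemma shellable_link (T V : choiceType) (Z : set {fset T}) (C : set {fset V})
    (tau : {fset T}) (g : V -> T)
    (star := fun G : {fset V} => (tau `|` [fset g v | v in G])%fset) :
  injective g -> (forall v, g v \notin tau) ->
  (forall G, C G <-> Z (star G)) ->
  (forall F, Z F -> (tau `<=` F)%fset -> exists G, F = star G) ->
  shellable Z -> shellable C.
Proof.
move=> g_inj gtau CZ starP [s /shellingP[us sZ sh]].
have in_star v G : (g v \in star G) = (v \in G).
  by rewrite inE (negPf (gtau v)) mem_imfset.
have star_sub G H : (star G `<=` star H)%fset = (G `<=` H)%fset.
  apply/idP/idP => /fsubsetP sub.
    by apply/fsubsetP => v; rewrite -!in_star; apply: sub.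
  by apply: fsetUS; apply: subset_imfset.
have star_inj : injective star.
  by move=> G H GH; apply/fsetP => v; rewrite -!in_star GH.
have tau_star G : (tau `<=` star G)%fset by apply: fsubsetUl.
(* The inverse of [star]; the default [fset0] is taken only off its image. *)
pose f F := xget fset0 [set G | F = star G].
have starK : cancel star f.
  move=> G; apply/esym/star_inj.
  by apply: (@xgetPex _ fset0 [set H | star G = star H]); exists G.
have fK F : Z F -> (tau `<=` F)%fset -> star (f F) = F.
  by move=> ZF /(starP _ ZF)[G ->]; rewrite starK.
pose t := [seq F <- s | (tau `<=` F)%fset].
have tZ F : F \in t -> facets Z F /\ star (f F) = F.
  rewrite mem_filter -sZ => /andP[tF Fs]; split=> //; apply: fK => //.
  by have [] : facets Z F by rewrite -sZ.
exists (map f t); apply/shellingP; split.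
- rewrite map_inj_in_uniq ?filter_uniq// => F G /tZ[_ FE] /tZ[_ GE] FG.
  by rewrite -FE -GE FG.
- apply/seteqP; split=> G /=.
    move=> /mapP[F /tZ[[ZF maxF] FE] ->]; split; first by apply/CZ; rewrite FE.
    move=> H /CZ ZH; rewrite -star_sub FE => /(maxF _ ZH) <-.
    by rewrite starK.
  move=> [CG maxG]; rewrite -(starK G); apply: map_f.
  (* A simplex of [Z] above [star G] contains [tau], so it is itself a star and the maximality of
     [G] applies. *)
  have : facets Z (star G).
    split; first exact/CZ.
    move=> F ZF sub; have FE := fK F ZF (fsubset_trans (tau_star G) sub).
    rewrite -FE; congr star; apply: maxG; first by apply/CZ; rewrite FE.
    by rewrite -star_sub FE.
  by rewrite -sZ /= mem_filter tau_star.
- move=> G' F' /subseqP[b sb E].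
  have [G [F [GFt -> ->]]] : exists G F, [/\ subseq [:: G; F] t, G' = f G & F' = f F].
    move: E; rewrite -map_mask; have := mask_subseq b t.
    by case: (mask b t) => [|G [|F []]] //= sub [-> ->]; exists G, F.
  have [Gt Ft] : G \in t /\ F \in t.
    by split; apply: (mem_subseq GFt); rewrite !inE eqxx ?orbT.
  have [tG tF] : (tau `<=` G)%fset /\ (tau `<=` F)%fset.
    by move: Gt Ft; rewrite !mem_filter => /andP[-> _] /andP[-> _].
  have [|H [HFs sub card1]] := sh G F.
    by apply: subseq_trans GFt (filter_subseq _ _).
  have tH : (tau `<=` H)%fset by apply: fsubset_trans sub; rewrite fsubsetI tG.
  have HFt : subseq [:: H; F] t by rewrite subseq_filter /= tH tF.
  have Ht : H \in t by apply: (mem_subseq HFt); rewrite !inE eqxx.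
  have [[[_ GE] [_ FE]] [_ HE]] := (tZ _ Gt, tZ _ Ft, tZ _ Ht).
  exists (f H); split; first exact: (map_subseq f HFt).
    apply/fsubsetP => v; rewrite inE -!in_star GE FE HE => vGF.
    by apply: (fsubsetP sub); rewrite inE.
  (* Both [F] and [H] contain [tau], which cancels in the difference; [g] is injective, so
     cardinality is kept. *)
  suff FHE : (F `\` H)%fset = [fset g v | v in (f F `\` f H)%fset]%fset.
    by rewrite FHE card_imfset in card1.
  apply/fsetP => x; rewrite -{1}FE -{1}HE; apply/idP/imfsetP => [|[v /= vFH ->]].
    rewrite in_fsetD in_fsetU [x \in star (f F)]in_fsetU.
    case/andP=> /norP[/negPf-> /= vH] /imfsetP[v /= vF xE].
    by exists v => //; rewrite inE vF andbT; apply: contra vH => ?; rewrite xE mem_imfset.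
  by move: vFH; rewrite !in_fsetD !in_star.
Qed.

Section Slices.
Variables (V : choiceType) (m : nat).
Implicit Types (i j : 'I_m) (F : {fset 'I_m * V}).

Lemma in_slice i F v : (v \in slice i F) = ((i, v) \in F).
Proof.
apply/imfsetP/idP => [[[j w] /=]|iv]; last by exists (i, v); rewrite //= !inE iv /=.
by rewrite inE /= => /andP[jw /eqP <-] ->.
Qed.

Lemma slice_subset i F F' : (F `<=` F')%fset -> (slice i F `<=` slice i F')%fset.
Proof. by move=> /fsubsetP FF; apply/fsubsetP => v; rewrite !in_slice; apply: FF. Qed.

Definition assemble (P : pred 'I_m) (phi : 'I_m -> {fset V}) : {fset 'I_m * V} :=
  (\bigcup_(j <- enum P) [fset (j, v) | v in phi j])%fset.

Lemma in_assemble (P : pred 'I_m) phi j v : ((j, v) \in assemble P phi) = P j && (v \in phi j).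
Proof.
apply/bigfcupP/andP => [[k] | [Pj vj]].
  by rewrite mem_enum andbT => Pk /imfsetP[w /= wk [-> ->]].
by exists j; rewrite ?mem_enum ?andbT //; apply: in_imfset.
Qed.

(* [C] is the link in [Z] of the simplex with slices [phi j] for [j != i]. *)
Lemma shellable_slice (Z : set {fset 'I_m * V}) (C : set {fset V}) i
    (phi : 'I_m -> {fset V}) :
  (forall F, Z F -> forall j, j != i -> (phi j `<=` slice j F)%fset ->
    slice j F = phi j) ->
  (forall F, (forall j, j != i -> slice j F = phi j) -> C (slice i F) <-> Z F) ->
  shellable Z -> shellable C.
Proof.
move=> Zphi CZ; pose tau := assemble (predC1 i) phi.
have slice_tau j : j != i -> slice j tau = phi j.
  by move=> ji; apply/fsetP => v; rewrite in_slice in_assemble /= ji.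
have itau v : (i, v) \notin tau by rewrite in_assemble /= eqxx.
have pair_inj : injective (pair i : V -> 'I_m * V) by move=> v w [].
have in_star j v (G : {fset V}) : ((j, v) \in tau `|` [fset (i, w) | w in G])%fset =
    if j == i then v \in G else v \in phi j.
  rewrite in_fsetU; case: eqP => [->|/eqP ji].
    by rewrite (negPf (itau v)) mem_imfset.
  rewrite -in_slice slice_tau //; case: (v \in phi j) => //=.
  by apply/negP => /imfsetP[w _ [/eqP]]; rewrite (negPf ji).
apply: (@shellable_link _ _ _ _ tau (pair i)) => // [G|F ZF tauF].
  set F := (tau `|` _)%fset.
  have {1}-> : G = slice i F by apply/fsetP => v; rewrite in_slice in_star eqxx.
  apply: CZ => j ji; apply/fsetP => v.
  by rewrite in_slice in_star (negPf ji).
(* Outside the [i]-th copy, [Zphi] leaves no freedom to a simplex containing [tau]. *)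
exists (slice i F); apply/fsetP => -[j v]; rewrite in_star -in_slice.
case: eqP => [->|/eqP ji] //; rewrite (Zphi F) //.
by rewrite -slice_tau //; apply: slice_subset.
Qed.

End Slices.

Theorem theorem4p6 (m : nat) (V : choiceType)
    (M : set {fset 'I_m}) (K L : set {fset V})
    (m_ge1 : 1 <= m)
    (M_complex : simplicial_complex M)
    (M_vertices : vertices M = [set: 'I_m])
    (M_not_simplex : ~ is_simplex M)
    (K_complex : simplicial_complex K)
    (L_complex : simplicial_complex L)
    (L_sub_K : L `<=` K)
    (K_neq_L : K <> L)
    (facets_sub : facets L `<=` facets K) :
  shellable (polyhedral_join M K L) -> shellable K /\ shellable L.
Proof.
have [M0 _ [nM nMP]] := M_complex.
have [_ _ [nK nKP]] := K_complex.
have [L0 Ldown [nL nLP]] := L_complex.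
have [G0 G0L _] := @exists_facet _ _ _ _ nLP L0.
have G0K := facets_sub _ G0L.
have [F0 F0K F0L] : exists2 F, facets K F & ~ L F.
  have [E KE LE] : exists2 E, K E & ~ L E.
    apply: contrapT => noE; apply: K_neq_L; apply/seteqP; split=> // E KE.
    by apply: contrapT => LE; apply: noE; exists E.
  have [F KF EF] := @exists_facet _ _ _ _ nKP KE.
  by exists F => // LF; apply: LE; apply: Ldown EF.
have [S [MS maxS] _] := @exists_facet _ _ _ _ nMP M0.
have [i0 i0S] : exists i, i \notin S.
  apply: contrapT => noi; apply: M_not_simplex; exists S => //.
  rewrite M_vertices; apply/seteqP; split=> // i _ /=.
  by apply: contrapT => /negP iS; apply: noi; exists i.
have sliceK F j : polyhedral_join M K L F -> K (slice j F).
  by move=> [S' _ /(_ j)]; case: ifP => // _ /L_sub_K.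
move=> Zsh; split.
- apply: (@shellable_slice V m _ K i0 (fun=> G0)) Zsh => [F ZF j _|F Fj].
    (* Here [G0] must be maximal in [K], not only in [L]: slices of simplices of the join lie in
       [K]. *)
    by have [_] := G0K; apply; apply: sliceK.
  split=> [KF|]; last exact: sliceK.
  exists [fset i0]%fset.
    by have : vertices M i0 by rewrite M_vertices.
  move=> j; rewrite inE; case: eqP => [->//|/eqP ji].
  by rewrite Fj//; case: G0L.
- pose phi (j : 'I_m) := if j \in S then F0 else G0.
  apply: (@shellable_slice V m _ L i0 phi) Zsh => [F ZF j _|F Fj].
    have : facets K (phi j) by rewrite /phi; case: ifP.
    by move=> [_]; apply; apply: sliceK.
  split=> [LF|[S' MS' S'F]].
    exists S => // j; have [->|ji] := eqVneq j i0; first by rewrite (negPf i0S).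
    by rewrite Fj // /phi; case: ifP => _; [case: F0K|case: G0L].
  (* A slice [F0], not being in [L], forces its index into [S']. Maximality of [S] then gives
     [S' = S], which misses [i0], so the slice at [i0] is in [L]. *)
  have SS' : (S `<=` S')%fset.
    apply/fsubsetP => j jS; apply: contrapT => /negP jS'; apply: F0L.
    have := S'F j; rewrite (negPf jS') Fj /phi ?jS //.
    by apply: contraNneq i0S => <-.
  by have := S'F i0; rewrite (maxS _ MS' SS') (negPf i0S).
Qed.
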